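(* Let $G$ be a connected graph. If $edim(G)=k$ and $G$ has diameter $D$, then $|E(G)|\le (D+1)^k$.
   Context: All graphs are finite and simple. For a connected graph $G=(V,E)$, $d_G(x,y)$ is the length of a shortest path between vertices $x,y$, and the diameter is the maximum of $d_G(x,y)$ over all pairs of vertices. The distance between a vertex $v$ and an edge $e=uw$ is $d_G(e,v)=\min\{d_G(u,v),d_G(w,v)\}$. A vertex $w$ distinguishes two edges $e_1,e_2$ if $d_G(w,e_1)\ne d_G(w,e_2)$. A set $S\subseteq V$ is an edge metric generator for $G$ if every two distinct edges of $G$ are distinguished by some vertex of $S$; the edge metric dimension $edim(G)$ is the smallest cardinality of an edge metric generator for $G$. *)

(* Defs.v *)
From mathcomp Require Import all_boot.

Set Implicit Arguments.
Unset Strict Implicit.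
Unset Printing Implicit Defensive.

Record sgraph := SGraph {
  vertex :> finType;
  adj : rel vertex;
  adj_sym : symmetric adj;
  adj_irr : irreflexive adj
}.

Definition connected (G : sgraph) : Prop :=
  forall x y : G, connect (@adj G) x y.

Definition edges (G : sgraph) : {set {set G}} :=
  [set f : {set G} | [exists x, exists y, adj x y && (f == [set x; y])]].

(* [x :: p] is the sequence of vertices of the path, so that [size p] is its
   length, i.e. its number of edges. *)
Definition graph_path (G : sgraph) (x y : G) (p : seq G) : bool :=
  [&& path (@adj G) x p, last x p == y & uniq (x :: p)].

(* The smallest n such that there is a path of length n from x to y; such an n
   is less than #|G| since the vertices of a path are distinct. The value is
   #|G| when there is no path, which does not happen in a connected graph. *)
Definition dist (G : sgraph) (x y : G) : nat :=
  find (fun n => [exists p : n.-tuple G, graph_path x y p]) (iota 0 #|G|).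

Definition diameter (G : sgraph) : nat :=
  \max_(x : G) \max_(y : G) dist x y.

(* The initial value #|G| is an upper bound of [dist], so it is neutral here;
   see [edge_dist2]. *)
Definition edge_dist (G : sgraph) (f : {set G}) (v : G) : nat :=
  \big[minn/#|G|]_(u in f) dist u v.

Definition distinguishes (G : sgraph) (w : G) (f1 f2 : {set G}) : bool :=
  edge_dist f1 w != edge_dist f2 w.

Definition edge_metric_generator (G : sgraph) (S : {set G}) : bool :=
  [forall f1 in edges G, forall f2 in edges G,
     (f1 != f2) ==> [exists w in S, distinguishes w f1 f2]].

(* The starting point [set: G] is always an edge metric generator; see
   [edge_metric_generatorT]. *)
Definition edim (G : sgraph) : nat :=
  #|[arg min_(S < [set: G] | edge_metric_generator S) #|S|]|.

Lemma dist_le_card (G : sgraph) (x y : G) : dist x y <= #|G|.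
Proof. by rewrite -[leqRHS](size_iota 0); apply: find_size. Qed.

Lemma dist_eq0 (G : sgraph) (x y : G) : (dist x y == 0) = (x == y).
Proof.
have cG : 0 < #|G| by apply/card_gt0P; exists x.
rewrite /dist; case: #|G| cG => //= n _; case: existsP => [[p]|noP].
  by rewrite (tuple0 p) => /and3P[_ /= ->].
by apply/esym/eqP => exy; apply: noP; exists [tuple]; rewrite /graph_path /= exy eqxx.
Qed.

Lemma edge_dist2 (G : sgraph) (u w v : G) :
  edge_dist [set u; w] v = minn (dist u v) (dist w v).
Proof.
rewrite /edge_dist; apply/eqP; rewrite eqn_leq; apply/andP; split.
  have le z : z \in [set u; w] ->
      \big[minn/#|G|]_(t in [set u; w]) dist t v <= dist z v.
    move=> zP; have := mem_index_enum z.
    elim: (index_enum G) => //= a s IH; rewrite inE big_cons.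
    case/orP=> [/eqP<-|/IH {}IH]; first by rewrite zP geq_minl.
    by case: ifP => // _; apply: leq_trans (geq_minr _ _) IH.
  by rewrite leq_min !le // !inE eqxx ?orbT.
elim/big_ind: _ => [|a b ha hb|z]; first by rewrite geq_min dist_le_card.
  by rewrite leq_min ha.
by rewrite !inE => /orP[] /eqP->; rewrite ?geq_minl ?geq_minr.
Qed.

Lemma edge_metric_generatorT (G : sgraph) : edge_metric_generator [set: G].
Proof.
have ed0 (f : {set G}) v : f \in edges G -> (edge_dist f v == 0) = (v \in f).
  rewrite inE => /existsP[x /existsP[y /andP[_ /eqP->]]].
  rewrite edge_dist2 !inE -leqn0 geq_min !leqn0 !dist_eq0.
  by rewrite eq_sym [y == v]eq_sym.
apply/forall_inP => f1 f1E; apply/forall_inP => f2 f2E; apply/implyP => ne12.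
apply/exists_inP; case: (pickP [pred w | (w \in f1) != (w \in f2)]) => [w /= hw|h].
  exists w; rewrite ?inE // /distinguishes; apply: contraNneq hw => e12.
  by rewrite -!ed0 // e12.
by case/eqP: ne12; apply/setP => w; have /negbFE/eqP := h w.
Qed.

(* Main.v *)
Require Import Defs.
From mathcomp Require Import all_boot.

(** Fix an edge metric generator S. The code of an edge f is the function
    that sends each w in S to the distance between f and w. Since S
    distinguishes any two edges, distinct edges have distinct codes; since the
    distance from an edge to a vertex is attained at an end of the edge, it is
    at most the diameter D, so there are at most (D + 1) ^ #|S| codes. A
    generator S of minimum size gives the bound. *)

Lemma dist_le_diameter (G : sgraph) (x y : G) : dist x y <= diameter G.
Proof.
apply: leq_trans (leq_bigmax (F := fun z => dist x z) y) _.
exact: (leq_bigmax (F := fun z => \max_(t : G) dist z t)).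
Qed.

(** The hypothesis excludes the empty set, whose distance to a vertex is #|G|,
    more than the diameter when the graph is connected. *)
Lemma edge_dist_le_diameter (G : sgraph) (f : {set G}) (w : G) :
  f \in edges G -> edge_dist f w <= diameter G.
Proof.
rewrite inE => /existsP[x /existsP[y /andP[_ /eqP->]]].
by rewrite edge_dist2 geq_min dist_le_diameter.
Qed.

Definition edge_code (G : sgraph) (S f : {set G}) :
    {ffun {w : G | w \in S} -> 'I_(diameter G).+1} :=
  [ffun w => inord (edge_dist f (val w))].

Lemma edge_code_inj (G : sgraph) (S : {set G}) :
  edge_metric_generator S -> {in edges G &, injective (edge_code G S)}.
Proof.
move=> genS f1 f2 f1E f2E eq_code; apply/eqP; apply: contraT => ne12.
have /forall_inP/(_ _ f1E)/forall_inP/(_ _ f2E)/implyP/(_ ne12) := genS.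
case/exists_inP=> w wS /eqP[].
have /ffunP/(_ (exist _ w wS)) := eq_code; rewrite !ffunE /= => eq_inord.
(* [inord] keeps the distances apart because neither exceeds the diameter. *)
by have := congr1 val eq_inord; rewrite /= !inordK // ltnS edge_dist_le_diameter.
Qed.

Lemma card_edges_le_generator (G : sgraph) (S : {set G}) :
  edge_metric_generator S -> #|edges G| <= (diameter G + 1) ^ #|S|.
Proof.
move=> genS; rewrite -(card_in_imset (edge_code_inj G S genS)).
by apply: leq_trans (max_card _) _; rewrite card_ffun card_ord card_sig addn1.
Qed.

Theorem proposition25 (G : sgraph) (k D : nat) (conG : connected G)
    (edimG : edim G = k) (diamG : diameter G = D) :
  #|edges G| <= (D + 1) ^ k.
Proof.
rewrite -edimG -diamG /edim.
case: arg_minnP => [|S genS _]; first exact: edge_metric_generatorT.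
exact: card_edges_le_generator.
Qed.
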